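(* Let $M$ be an Orlicz function satisfying the $\Delta_2^\infty$-condition. Then $(L_M)_U=\Delta(\ell_{M_{\bar\beta}})_{\bar\beta\in\mathcal B}$ with equivalent norms, where $\|a\|_{\Delta(\ell_{M_{\bar\beta}})}:=\sup_{\bar\beta\in\mathcal B}\|a\|_{\ell_{M_{\bar\beta}}}$. Moreover, the continuous embeddings $$\ell_{\Phi_M}\hookrightarrow(L_M)_U\hookrightarrow\ell_{p_M}$$ hold.
   Context: An Orlicz function is an increasing convex continuous $M:[0,\infty)\to[0,\infty)$ with $M(0)=0$, $M(t)\to\infty$, normalized by $M(1)=1$; $M\in\Delta_2^\infty$ means $\sup_{u\ge1}M(2u)/M(u)<\infty$. $L_M=L_M[0,1]$ (Lebesgue measure) has the Luxemburg norm $\|f\|_{L_M}:=\inf\{\lambda>0:\int_0^1M(|f|/\lambda)\le1\}$. For a Banach lattice $X$, $\mathfrak B_n(X)$ is the set of $n$-tuples of pairwise disjoint ($|x_i|\wedge|x_j|=0$) norm-one elements; $\|a\|_{X_U(n)}:=\sup\{\|\sum_{i=1}^na_ix_i\|_X:(x_i)\in\mathfrak B_n(X)\}$ for $a\in\mathbb R^n$, and $X_U$ is the space of real sequences with $\|a\|_{X_U}:=\sup_n\|(a_i)_{i=1}^n\|_{X_U(n)}<\infty$. $M_v(u):=M(uv)/M(v)$ for $u\ge0,v>0$. $\mathcal B$ is the set of sequences $\bar\beta=(\beta_k)_{k\ge1}$ of positive reals with $\sum_k1/M(\beta_k)\le1$. The Musielak–Orlicz space $\ell_{M_{\bar\beta}}$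 consists of sequences $a$ with $\|a\|_{\ell_{M_{\bar\beta}}}:=\inf\{\lambda>0:\sum_kM_{\beta_k}(|a_k|/\lambda)\le1\}<\infty$; $\Delta(\ell_{M_{\bar\beta}})_{\bar\beta\in\mathcal B}$ is the set of $a\in\bigcap_{\bar\beta}\ell_{M_{\bar\beta}}$ with finite $\sup_{\bar\beta\in\mathcal B}\|a\|_{\ell_{M_{\bar\beta}}}$. $\Phi_M(u):=\sup_{v\ge\max(1,1/u)}M(vu)/M(v)$, $u>0$ ($\Phi_M(0)=0$), and $\ell_{\Phi_M}$ is the sequence space with norm $\inf\{\lambda>0:\sum_k\Phi_M(|a_k|/\lambda)\le1\}$. $p_M:=\sup\{p\ge1:\exists C>0,\ M(uv)\le Cu^pM(v)\ \text{for all }0<u\le1,\ uv\ge1\}$. *)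

(* Defs.v *)
From mathcomp Require Import all_boot all_order all_algebra.
From mathcomp Require Import all_classical all_reals all_analysis.
Set Implicit Arguments. Unset Strict Implicit. Unset Printing Implicit Defensive.
Import Order.TTheory GRing.Theory Num.Theory.
Import numFieldNormedType.Exports.
Local Open Scope classical_set_scope.
Local Open Scope ring_scope.

Section Orlicz.
Context {R : realType}.

(* Orlicz function (only its values on [0,+oo) matter), normalized M 1 = 1. *)
Definition orlicz_function (M : R -> R) : Prop :=
  [/\ {in `[0, +oo[ &, {homo M : x y / x <= y}},
      (forall x y t, 0 <= x -> 0 <= y -> 0 <= t <= 1 ->
         M (t * x + (1 - t) * y) <= t * M x + (1 - t) * M y),
      {within `[0, +oo[, continuous M},
      M 0 = 0 /\ M 1 = 1 &
      (M t @[t --> +oo] --> +oo)].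

Definition delta2_infty (M : R -> R) : Prop :=
  exists K : R, forall u, 1 <= u -> M (2 * u) / M u <= K.

Definition leb := (@lebesgue_measure R).

(* Luxemburg norm of f on [0,1] (value +oo when f is not in L_M) *)
Definition lux_norm (M : R -> R) (f : R -> R) : \bar R :=
  ereal_inf [set (l%:E) | l in [set l : R | 0 < l /\
     (\int[leb]_(x in `[0%R, 1%R]) (M (`|f x| / l))%:E <= 1)%E]].

Definition frakB (M : R -> R) (n : nat) (x : 'I_n -> R -> R) : Prop :=
  (forall i, measurable_fun (`[0%R, 1%R] : set R) (x i) /\ lux_norm M (x i) = 1%E) /\
  (forall i j, i != j ->
     leb.-negligible [set t | t \in `[0%R, 1%R] /\ Num.min `|x i t| `|x j t| != 0]).

(* ||(a_i)_{i<n}||_{(L_M)_U(n)}  (sequences are indexed from 0) *)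
Definition XUn_norm (M : R -> R) (n : nat) (a : nat -> R) : \bar R :=
  ereal_sup [set lux_norm M (fun t => \sum_(i < n) a i * x i t)
            | x in [set x : 'I_n -> R -> R | frakB M x]].

Definition XU_norm (M : R -> R) (a : nat -> R) : \bar R :=
  ereal_sup [set XUn_norm M n a | n in [set: nat]].

Definition in_XU (M : R -> R) (a : nat -> R) : Prop := (XU_norm M a < +oo)%E.

Definition Mv (M : R -> R) (v u : R) : R := M (u * v) / M v.

(* the set \mathcal B (1/M(beta_k) is +oo if M(beta_k) = 0, so such beta are excluded) *)
Definition calB (M : R -> R) : set (nat -> R) :=
  [set b | (forall k, 0 < b k /\ 0 < M (b k)) /\
           (\sum_(0 <= k <oo) ((M (b k))^-1)%:E <= 1)%E].

(* Musielak-Orlicz norm ||a||_{l_{M_beta}} (+oo if a is not in the space) *)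
Definition lMbeta_norm (M : R -> R) (b : nat -> R) (a : nat -> R) : \bar R :=
  ereal_inf [set (l%:E) | l in [set l : R | 0 < l /\
     (\sum_(0 <= k <oo) (Mv M (b k) (`|a k| / l))%:E <= 1)%E]].

Definition Delta_norm (M : R -> R) (a : nat -> R) : \bar R :=
  ereal_sup [set lMbeta_norm M b a | b in calB M].

Definition in_Delta (M : R -> R) (a : nat -> R) : Prop :=
  (forall b, calB M b -> (lMbeta_norm M b a < +oo)%E) /\ (Delta_norm M a < +oo)%E.

Definition PhiM (M : R -> R) (u : R) : \bar R :=
  if u == 0 then 0%E else
  ereal_sup [set (M (v * u) / M v)%:E | v in [set v : R | Num.max 1 u^-1 <= v]].

Definition lPhi_norm (M : R -> R) (a : nat -> R) : \bar R :=
  ereal_inf [set (l%:E) | l in [set l : R | 0 < l /\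
     (\sum_(0 <= k <oo) PhiM M (`|a k| / l) <= 1)%E]].

Definition pM (M : R -> R) : \bar R :=
  ereal_sup [set (p%:E) | p in [set p : R | 1 <= p /\ exists C : R, 0 < C /\
     forall u v, 0 < u <= 1 -> 1 <= u * v -> M (u * v) <= C * u `^ p * M v]].

(* ell_p norm, p >= 1 real: (sum |a_k|^p)^(1/p), +oo if the series diverges *)
Definition lp_norm (p : R) (a : nat -> R) : \bar R :=
  poweR (\sum_(0 <= k <oo) (`|a k| `^ p)%:E)%E p^-1.

End Orlicz.

(* Main.v *)
Require Import Defs.
From mathcomp Require Import all_boot all_order all_algebra.
From mathcomp Require Import all_classical all_reals all_analysis.
From mathcomp Require Import measurable_realfun ring lra.
Set Implicit Arguments. Unset Strict Implicit. Unset Printing Implicit Defensive.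
Import Order.TTheory GRing.Theory Num.Theory.
Import numFieldNormedType.Exports.
Local Open Scope classical_set_scope.
Local Open Scope ring_scope.

(** A ball of radius [l] for the norm of [Delta] is a family of inequalities
    over all [b] in [calB], and everything goes through it.

    [Delta <= (L_M)_U]: test with [x_k = b_k 1_(A_k)], where the [A_k] are
    disjoint intervals of length [1 / M (b_k)].

    [(L_M)_U <= 12 Delta]: write [int M(u |x_i|)] as an average of
    [M_v(u)], [v = |x_i(t)|], against [M(|x_i|) dt].  Raising the values of
    [|x_i|] below the level [w_i] with [M(w_i) ~ 1 / |supp x_i|] costs only a
    constant and makes every sequence [v_i >= w_i] a member of [calB], so the
    averages may be replaced by suprema over [v_i >= w_i].

    [Delta <= 2 l_Phi]: [M_v(u) <= Phi_M(u) + 1 / M(v)] for [v >= 1].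

    [l_(p_M) <= 2 Delta]: for [0 < u < 1] and [q > p_M] the inequality
    [M(uv) <= u^q M(v)] fails for arbitrarily large [v]; with [q] close to
    [p_M] this gives [M_v(u) >= u^p_M / 2], and the [b_k] may be chosen
    accordingly, one [u = |a_k| / l] at a time. *)

(** * Series, infima and norm inequalities in the extended reals *)

Section ExtendedReals.
Context {R : realType}.

Lemma nneseries_leP (u : nat -> R) (B : R) : (forall k, 0 <= u k) ->
  (\sum_(0 <= k <oo) (u k)%:E <= B%:E)%E <-> forall n, \sum_(i < n) u i <= B.
Proof.
move=> u0; split=> [uB n|uB].
  rewrite -lee_fin (le_trans _ uB)// -sumEFin -(big_mkord xpredT (fun i => (u i)%:E)).
  by apply: nneseries_lim_ge => i _ _; rewrite lee_fin.
apply: lime_le; first by apply: is_cvg_nneseries => i _ _; rewrite lee_fin.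
by apply: nearW => n; rewrite big_mkord sumEFin lee_fin.
Qed.

Lemma sum_half_le1 n : \sum_(i < n) (2^-1 : R) ^+ i.+1 <= 1.
Proof.
suff -> : \sum_(i < n) (2^-1 : R) ^+ i.+1 = 1 - 2^-1 ^+ n.
  by rewrite lerBlDr lerDl exprn_ge0.
elim: n => [|n IH]; first by rewrite big_ord0 expr0 subrr.
by rewrite big_ord_recr /= IH exprS; lra.
Qed.

(** Reduces a norm inequality to an inclusion of balls. Only radii strictly above [x] are tested, so
    no infimum has to be attained. *)
Lemma lee_of_gt (C : R) (x y : \bar R) : 0 < C -> (0 <= x)%E ->
  (forall l, 0 < l -> (x < l%:E)%E -> (y <= (C * l)%:E)%E) -> (y <= C%:E * x)%E.
Proof.
move=> C0; case: x => [r| |]// r0 H; last by rewrite gt0_muley ?leey// lte_fin.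
apply/lee_addgt0Pr => e e0.
have eC : 0 < e / C by rewrite divr_gt0.
rewrite -EFinM -EFinD -[e](mulfVK (lt0r_neq0 C0)) (mulrC (e / C)) -mulrDr.
by apply: H; rewrite ?lte_fin ?ltrDl ?ltr_wpDl// -lee_fin.
Qed.

Lemma inf_norm_ge0 (P : set R) :
  (0 <= ereal_inf [set l%:E | l in [set l : R | (0 < l)%R /\ P l]])%E.
Proof. by apply: le_ereal_inf_tmp => _ [l [/ltW l0 _] <-]; rewrite lee_fin. Qed.

(** Strictness supplies an admissible [s < l], and monotonicity of [P] carries it up to [l]. *)
Lemma inf_norm_lt (P : set R) (l : R) :
  (forall s t, 0 < s -> s <= t -> P s -> P t) ->
  (ereal_inf [set l%:E | l in [set l : R | (0 < l)%R /\ P l]] < l%:E)%E -> P l.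
Proof.
move=> mono /ereal_inf_lt[_ [s [s0 Ps] <-]].
by rewrite lte_fin => /ltW sl; exact: mono Ps.
Qed.

Lemma inf_norm_le (P : set R) (l : R) : 0 < l -> P l ->
  (ereal_inf [set l%:E | l in [set l : R | (0 < l)%R /\ P l]] <= l%:E)%E.
Proof. by move=> l0 Pl; apply: ereal_inf_lbound; exists l. Qed.

Lemma expr_small (z e : R) : 0 <= z < 1 -> 0 < e ->
  exists n, z ^+ n < e.
Proof.
move=> /andP[z0 z1] e0; have z1' : `|z| < 1 by rewrite ger0_norm.
have := @cvgr0_norm_lt _ R^o _ _ _ _ (cvg_expr z1') e e0.
by case=> n _ /(_ n (leqnn n)) /=; rewrite ger0_norm ?exprn_ge0//; exists n.
Qed.

End ExtendedReals.

(** * Orlicz functions and the families [calB] *)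

Section OrliczFunctions.
Context {R : realType} {M : R -> R} (HM : orlicz_function M).

Lemma orlicz_le x y : 0 <= x -> x <= y -> M x <= M y.
Proof.
case: HM => H _ _ _ _ x0 xy; apply: H => //; rewrite in_itv/= andbT//.
exact: le_trans xy.
Qed.

Lemma orlicz0 : M 0 = 0. Proof. by case: HM => _ _ _ [-> _]. Qed.

Lemma orlicz1 : M 1 = 1. Proof. by case: HM => _ _ _ [_ ->]. Qed.

Lemma orlicz_ge0 x : 0 <= x -> 0 <= M x.
Proof. by move=> x0; rewrite -orlicz0 orlicz_le. Qed.

Lemma orlicz_scale t x : 0 <= t <= 1 -> 0 <= x -> M (t * x) <= t * M x.
Proof.
case: HM => _ H _ [M0 _] _ t01 x0.
by have := H x 0 t x0 (lexx _) t01; rewrite M0 !mulr0 !addr0.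
Qed.

Lemma orlicz_ge1 x : 1 <= x -> 1 <= M x.
Proof. by move=> x1; rewrite -orlicz1 orlicz_le. Qed.

(** For [x < 1] convexity gives [M x <= x < 1]; monotonicity alone would give only [M x <= 1]. *)
Lemma orlicz_ge1_inv x : 0 <= x -> 1 <= M x -> 1 <= x.
Proof.
move=> x0 Mx; rewrite leNgt; apply/negP => x1.
have : M (x * 1) <= x * M 1 by apply: orlicz_scale; rewrite // x0 ltW.
by rewrite mulr1 orlicz1; lra.
Qed.

Lemma orlicz_gt0 x : 1 <= x -> 0 < M x.
Proof. by move/orlicz_ge1; exact: lt_le_trans. Qed.

Lemma orlicz_unbounded y : exists2 v, 1 <= v & y <= M v.
Proof.
case: HM => _ _ _ _ /cvgryPge /(_ y) [A [_ H]].
exists (Num.max 1 (A + 1)); first by rewrite le_max lexx.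
by apply: H; rewrite /= lt_max ltrDl ltr01 orbT.
Qed.

Lemma orlicz_surj y : 1 <= y -> exists2 v, 1 <= v & M v = y.
Proof.
move=> y1; have [b b1 yb] := orlicz_unbounded y.
have [||c] := @IVT R M 1 b y b1.
- case: HM => _ _ cM _ _; apply: continuous_subspaceW cM => x /=.
  by rewrite !in_itv/= andbT => /andP[/(le_trans ler01)].
- rewrite orlicz1 ge_min y1/= le_max yb orbT//.
by rewrite in_itv/= => /andP[c1 _] Mc; exists c.
Qed.

Lemma Mv_ge0 v u : 0 <= v -> 0 <= u -> 0 <= Mv M v u.
Proof. by move=> v0 u0; rewrite divr_ge0// orlicz_ge0// mulr_ge0. Qed.

Lemma Mv_le v (s t : R) : 0 <= v -> 0 <= s -> s <= t -> Mv M v s <= Mv M v t.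
Proof.
move=> v0 s0 st; rewrite ler_wpM2r ?invr_ge0 ?orlicz_ge0//.
by rewrite orlicz_le ?mulr_ge0// ler_wpM2r.
Qed.

Lemma Mv_scale v t u : 0 <= v -> 0 <= t <= 1 -> 0 <= u ->
  Mv M v (t * u) <= t * Mv M v u.
Proof.
move=> v0 t01 u0; rewrite mulrA ler_wpM2r ?invr_ge0 ?orlicz_ge0//.
by rewrite -mulrA orlicz_scale ?mulr_ge0.
Qed.

(** If [u > 1], scaling by [1/u] gives [1 = M_v(1) <= M_v(u) / u < M_v(u)]. *)
Lemma Mv_le1_inv v u : 1 <= v -> 0 <= u -> Mv M v u <= 1 -> u <= 1.
Proof.
move=> v1 u0 H; rewrite leNgt; apply/negP => u1.
have v0 : 0 <= v by apply: le_trans v1.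
have up : 0 < u by exact: lt_trans u1.
have Mv0 := orlicz_gt0 v1.
have : Mv M v (u^-1 * u) <= u^-1 * Mv M v u.
  by apply: Mv_scale => //; rewrite invr_ge0 u0 invf_le1// ltW.
rewrite mulVf ?gt_eqF// [leLHS]/Mv mul1r divff ?gt_eqF//.
have : u^-1 < 1 by rewrite invf_lt1.
have : 0 < u^-1 by rewrite invr_gt0.
by nra.
Qed.

Lemma calBP b : calB M b <->
  (forall k, 0 < b k /\ 0 < M (b k)) /\
  forall n, \sum_(i < n) (M (b i))^-1 <= 1.
Proof.
suff H : (forall k, 0 < b k /\ 0 < M (b k)) ->
    (\sum_(0 <= k <oo) ((M (b k))^-1)%:E <= 1)%E <->
    forall n, \sum_(i < n) (M (b i))^-1 <= 1.
  by split=> -[b0 bS]; split=> //; apply/H.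
by move=> b0; apply: nneseries_leP => k; rewrite invr_ge0 ltW// (b0 k).2.
Qed.

(** Mainly used with [q k = 1 / M(w k)] for a member [w]: [calB] is stable under increasing the
    terms. *)
Lemma calB_of_le b (q : nat -> R) : (forall k, 1 <= b k) ->
  (forall k, (M (b k))^-1 <= q k) -> (forall n, \sum_(i < n) q i <= 1) ->
  calB M b.
Proof.
move=> b1 bq qS; apply/calBP; split=> [k|n].
  by split; [exact: lt_le_trans (b1 k)|exact: orlicz_gt0].
by apply: le_trans (qS n); apply: ler_sum.
Qed.

Lemma calB_inv_le1 b k : calB M b -> (M (b k))^-1 <= 1.
Proof.
move=> /calBP[b0 /(_ k.+1)]; rewrite big_ord_recr/=; apply: le_trans.
by rewrite lerDr sumr_ge0// => i _; rewrite invr_ge0 ltW// (b0 i).2.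
Qed.

Lemma calB_ge1 b k : calB M b -> 1 <= b k.
Proof.
move=> bB; have /calBP[/(_ k)[b0 Mb0] _] := bB.
apply: orlicz_ge1_inv; first exact: ltW.
by rewrite -(invf_le1 Mb0) calB_inv_le1.
Qed.

(** * Balls of the norm of [Delta], described by finite partial sums *)

Definition beta_ball (a : nat -> R) (l : R) := forall b, calB M b ->
  forall n, \sum_(i < n) Mv M (b i) (`|a i| / l) <= 1.

Lemma lMbeta_le b (a : nat -> R) (l : R) : calB M b -> 0 < l ->
  (forall n, \sum_(i < n) Mv M (b i) (`|a i| / l) <= 1) ->
  (lMbeta_norm M b a <= l%:E)%E.
Proof.
move=> bB l0 H; apply: inf_norm_le => //; apply/(nneseries_leP _ _).2 => // k.
by rewrite Mv_ge0 ?divr_ge0 ?(ltW l0)// ltW//; case: bB => /(_ k)[].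
Qed.

Lemma lMbeta_lt b (a : nat -> R) (l : R) : calB M b -> 0 < l -> (lMbeta_norm M b a < l%:E)%E ->
  forall n, \sum_(i < n) Mv M (b i) (`|a i| / l) <= 1.
Proof.
move=> bB l0 H; have b0 k : 0 <= b k by case: bB => /(_ k)[/ltW].
have u0 k : 0 <= Mv M (b k) (`|a k| / l) by rewrite Mv_ge0// divr_ge0// ltW.
apply: (nneseries_leP 1 u0).1; apply: inf_norm_lt H => s t s0 st; apply: le_trans.
have t0 : 0 < t by exact: lt_le_trans st.
apply: lee_nneseries => [k _ _|k _]; rewrite lee_fin.
  by rewrite Mv_ge0// divr_ge0// ltW.
by rewrite Mv_le ?divr_ge0 ?(ltW t0)// ler_wpM2l// lef_pV2.
Qed.

Lemma Delta_le (a : nat -> R) (l : R) : 0 < l -> beta_ball a l -> (Delta_norm M a <= l%:E)%E.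
Proof.
by move=> l0 H; apply: ge_ereal_sup => _ [b bB <-]; apply: lMbeta_le => // n; exact: H.
Qed.

Lemma Delta_lt (a : nat -> R) (l : R) : 0 < l -> (Delta_norm M a < l%:E)%E -> beta_ball a l.
Proof.
move=> l0 H b bB; apply: lMbeta_lt => //; apply: le_lt_trans H.
by apply: ereal_sup_ubound; exists b.
Qed.

(** Terms with [M(v k) >= 2^(k+1)] have reciprocals of sum at most 1. With [q = 0] this provides a
    member of [calB]. *)
Lemma calB_ge (q : nat -> R) : exists2 b, calB M b & forall k, q k <= b k.
Proof.
have /choice[v vP] : forall k, exists v, 1 <= v /\ 2 ^+ k.+1 <= M v.
  by move=> k; have [v v1 Mv] := orlicz_unbounded (2 ^+ k.+1); exists v.
exists (fun k => Num.max (q k) (v k)); last by move=> k; rewrite le_max lexx.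
apply: (calB_of_le (q := fun k => 2^-1 ^+ k.+1)) => [k|k|]; last exact: sum_half_le1.
  by rewrite le_max (vP k).1 orbT.
have [v1 Mv] := vP k.
rewrite exprVn lef_pV2 ?posrE ?exprn_gt0//.
  by apply: le_trans Mv _; rewrite orlicz_le ?le_max ?lexx ?orbT// (le_trans _ v1).
by rewrite orlicz_gt0// le_max v1 orbT.
Qed.

Lemma Delta_ge0 a : (0 <= Delta_norm M a)%E.
Proof.
have [b bB _] := calB_ge (fun=> 0).
by apply: le_ereal_sup_tmp; exists (lMbeta_norm M b a); [exists b|exact: inf_norm_ge0].
Qed.

(** * The function [Phi_M] and the ball of [l_Phi] *)

Lemma PhiM_ge0 u : 0 <= u -> (0 <= PhiM M u)%E.
Proof.
move=> u0; rewrite /PhiM; case: eqP => // _.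
set v := Num.max 1 u^-1; have v1 : 1 <= v by rewrite le_max lexx.
apply: le_ereal_sup_tmp; exists (M (v * u) / M v)%:E; first by exists v => //=.
have v0 := le_trans ler01 v1.
by rewrite lee_fin divr_ge0 ?orlicz_ge0// mulr_ge0.
Qed.

Lemma PhiM_le s t : 0 <= s -> s <= t -> (PhiM M s <= PhiM M t)%E.
Proof.
move=> s0 st; rewrite {1}/PhiM; case: eqP => [_|/eqP sN0].
  by rewrite PhiM_ge0// (le_trans s0).
have sp : 0 < s by rewrite lt0r sN0.
have tp : 0 < t by exact: lt_le_trans st.
rewrite /PhiM gt_eqF//; apply: ge_ereal_sup => _ [v /= + <-].
rewrite ge_max => /andP[v1 vs].
have v0 : 0 <= v by exact: le_trans v1.
apply: le_ereal_sup_tmp; exists (M (v * t) / M v)%:E.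
  exists v => //=; rewrite ge_max v1/= (le_trans _ vs)// lef_pV2//.
rewrite lee_fin ler_wpM2r ?invr_ge0 ?orlicz_ge0// orlicz_le ?mulr_ge0//.
by rewrite ler_wpM2l.
Qed.

(** If [u v >= 1], then [v] competes in the supremum defining [Phi_M(u)]; otherwise
    [M(u v) <= M(1) = 1]. *)
Lemma Mv_le_PhiM v u : 1 <= v -> 0 <= u ->
  ((Mv M v u)%:E <= PhiM M u + ((M v)^-1)%:E)%E.
Proof.
move=> v1 u0; have Mv0 := orlicz_gt0 v1; have v0 := le_trans ler01 v1.
have [uv|uv] := leP 1 (u * v).
  apply: lee_paddr; first by rewrite lee_fin invr_ge0 ltW.
  have up : 0 < u.
    by rewrite lt0r u0 andbT; apply: contraTneq uv => ->; rewrite mul0r -ltNge ltr01.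
  rewrite /PhiM gt_eqF//; apply: le_ereal_sup_tmp; exists (M (v * u) / M v)%:E.
    by exists v => //=; rewrite ge_max v1/= -[_^-1]mul1r ler_pdivrMr// mulrC.
  by rewrite /Mv (mulrC u).
apply: lee_paddl; first exact: PhiM_ge0.
rewrite lee_fin /Mv -[leRHS]mul1r ler_wpM2r ?invr_ge0 ?(ltW Mv0)//.
by rewrite -orlicz1 orlicz_le ?mulr_ge0// ltW.
Qed.

Lemma lPhi_lt (a : nat -> R) (l : R) : 0 < l -> (lPhi_norm M a < l%:E)%E -> beta_ball a (2 * l).
Proof.
move=> l0 H b bB.
have {}H : (\sum_(0 <= k <oo) PhiM M (`|a k| / l) <= 1)%E.
  apply: inf_norm_lt H => s t s0 st; apply: le_trans.
  have t0 : 0 < t by exact: lt_le_trans st.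
  apply: lee_nneseries => [k _ _|k _].
    by rewrite PhiM_ge0// divr_ge0// ltW.
  by rewrite PhiM_le ?divr_ge0 ?(ltW t0)// ler_wpM2l// lef_pV2.
move=> n; have b1 i := calB_ge1 i bB; have b0 i := le_trans ler01 (b1 i).
have al0 i : 0 <= `|a i| / l by rewrite divr_ge0// ltW.
(* The 2 is 1 from the [Phi_M] series plus 1 from [calB]; convexity trades it for the doubled
   radius. *)
suff H2 : \sum_(i < n) Mv M (b i) (`|a i| / l) <= 2.
  apply: (@le_trans _ _ (\sum_(i < n) 2^-1 * Mv M (b i) (`|a i| / l))).
    apply: ler_sum => i _; rewrite invfM (mulrC _ l^-1) mulrA mulrC Mv_scale//.
    by lra.
  by rewrite -mulr_sumr; lra.
have /calBP[_ bS] := bB.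
rewrite -lee_fin -sumEFin.
apply: (@le_trans _ _ (\sum_(i < n) (PhiM M (`|a i| / l) + ((M (b i))^-1)%:E))%E).
  by apply: lee_sum => i _; exact: Mv_le_PhiM.
rewrite big_split/= (_ : 2%:E = 1 + 1)%E// leeD//.
  apply: le_trans H; rewrite -(big_mkord xpredT (fun i => PhiM M (`|a i| / l))).
  by apply: nneseries_lim_ge => i _ _; exact: PhiM_ge0.
rewrite sumEFin -[leRHS]/(1%:E) lee_fin; exact: bS.
Qed.

(** * The index [pM] *)

Definition index_set := [set p : R | 1 <= p /\ exists C : R, 0 < C /\
  forall u v, 0 < u <= 1 -> 1 <= u * v -> M (u * v) <= C * u `^ p * M v].

(** This is convexity with [C = 1]; it gives [p_M >= 1]. *)
Lemma index_set1 : index_set 1.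
Proof.
split=> //; exists 1; split=> // u v /andP[u0 u1] uv.
rewrite powRr1 ?(ltW u0)// mul1r orlicz_scale ?(ltW u0) ?u1//.
by rewrite -(pmulr_rge0 _ u0) (le_trans ler01).
Qed.

Lemma pM_ge1 : (1 <= pM M)%E.
Proof. by apply: ereal_sup_ubound; exists 1 => //; exact: index_set1. Qed.

(** Iterating the doubling condition gives [M(2^n) <= K^n]. Testing an admissible [p] at [u = 2^-n],
    [v = 2^n] gives [1 <= C (2^-p K)^n] for all [n], hence [2^p <= K]. *)
Lemma pM_lty : delta2_infty M -> (pM M < +oo)%E.
Proof.
move=> [K HK].
have M2 n : M (2 ^+ n) <= K ^+ n.
  elim: n => [|n IH]; first by rewrite !expr0 orlicz1.
  have n1 : 1 <= (2 : R) ^+ n by rewrite exprn_ege1// ler1n.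
  have := HK _ n1; rewrite ler_pdivrMr ?orlicz_gt0// -exprS => /le_trans; apply.
  rewrite exprS ler_wpM2l// (le_trans _ (HK _ (lexx 1)))//.
  by rewrite divr_ge0 ?orlicz_ge0// mulr1.
have K1 : 1 <= K by have := M2 1%N; rewrite !expr1; apply: le_trans; rewrite orlicz_ge1// ler1n.
(* This bound on [p] comes from [p ln 2 <= 2^p <= K]. *)
apply: (@le_lt_trans _ _ (K / ln 2)%:E); last by rewrite ltry.
apply: ge_ereal_sup => _ [p [p1 [C [C0 HC]]] <-]; rewrite lee_fin.
have ln2 : 0 < ln (2 : R) by rewrite ln_gt0// ltr1n.
set z := (2^-1 : R) `^ p * K.
have z0 : 0 <= z by rewrite mulr_ge0 ?powR_ge0// (le_trans _ K1).
have Cz n : 1 <= C * z ^+ n.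
  have /HC : 0 < (2^-1 : R) ^+ n <= 1.
    by rewrite exprn_gt0//= exprn_ile1// invf_le1 ?ler1n.
  move=> /(_ (2 ^+ n)); rewrite -exprMn mulVf// expr1n lexx orlicz1 => /(_ isT).
  move=> /le_trans; apply; rewrite -mulrA ler_wpM2l ?(ltW C0)// /z exprMn.
  have -> : (2^-1 ^+ n : R) `^ p = (2^-1 `^ p) ^+ n.
    by rewrite -powR_mulrn// powRAC powR_mulrn// powR_ge0.
  by rewrite ler_wpM2l ?exprn_ge0 ?powR_ge0.
have z1 : 1 <= z.
  rewrite leNgt; apply/negP => z1.
  have [||n] := @expr_small _ z C^-1; rewrite ?invr_gt0// ?z0//.
  by rewrite -(ltr_pM2l C0) mulfV ?gt_eqF// ltNge Cz.
have : (2 : R) `^ p <= K.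
  have p2 : 0 < (2 : R) `^ p by rewrite powR_gt0.
  move: z1; rewrite /z -powR_inv1// -powRrM mulN1r powRN mulrC.
  by rewrite ler_pdivlMr// mul1r.
rewrite ler_pdivlMr//; apply: le_trans; rewrite /powR pnatr_eq0/=.
by apply: le_trans (expR_ge1Dx _); rewrite lerDr.
Qed.

Lemma index_set_le p : index_set p -> (p%:E <= pM M)%E.
Proof. by move=> Hp; apply: ereal_sup_ubound; exists p. Qed.

(* If [M (u v) <= u^q M v] for all large [v], iterating the inequality puts [q]
   in the set defining [p_M]. *)
Lemma index_gt u q V : 0 < u < 1 -> 1 <= q -> (pM M < q%:E)%E ->
  exists2 v, V <= v /\ 1 <= v & u `^ q * M v < M (u * v).
Proof.
move=> /andP[u0 u1] q1 pq; apply: contrapT => Hn.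
have {}Hn v : V <= v -> 1 <= v -> M (u * v) <= u `^ q * M v.
  by move=> Vv v1; rewrite leNgt; apply/negP => ?; apply: Hn; exists v.
have q0 : 0 <= q by exact: le_trans q1.
suff /index_set_le : index_set q by rewrite leNgt pq.
(* With the constant [W^q] the bound is trivial once [W x >= 1]. While [W x < 1], both [x <= u] and
   [V <= v] hold, so the assumed inequality applies at [v]. *)
split=> //; pose W := Num.max V u^-1.
have W0 : 0 < W by rewrite lt_max invr_gt0 u0 orbT.
have W1 : 1 <= W by rewrite le_max [X in _ || X]ltW ?orbT// invf_gt1.
exists (W `^ q); rewrite powR_gt0//; split=> // x v /andP[x0 x1] xv.
rewrite -powRM ?(ltW W0) ?(ltW x0)//.
have [k] := @expr_small _ u x (introT andP (conj (ltW u0) u1)) x0.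
(* Each step replaces [(x, v)] by [(x / u, u v)], which keeps the product and lowers [k] in
   [u^k < x]; [k = 0] would contradict [x <= 1]. *)
elim: k x v x0 x1 xv => [|k IH] x v x0 x1 xv; first by rewrite expr0 ltNge x1.
move=> ux.
have v0 : 0 < v by rewrite -(pmulr_rgt0 _ x0) (lt_le_trans _ xv).
have v1 : 1 <= v by rewrite (le_trans xv)// ler_piMl// ltW.
have [Wx|Wx] := leP 1 (W * x).
  apply: (@le_trans _ _ (M v)).
    by rewrite orlicz_le ?mulr_ge0 ?ler_piMl// ltW.
  rewrite ler_peMl ?orlicz_ge0 ?(ltW v0)//.
  have := @ge0_ler_powR _ q q0 1 (W * x); rewrite powR1 !nnegrE; apply=> //.
  by rewrite mulr_ge0// ltW.
have xu : x <= u.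
  have : u^-1 * x < 1 by apply: le_lt_trans Wx; rewrite ler_wpM2r ?le_max ?lexx ?orbT// ltW.
  by rewrite mulrC ltr_pdivrMr// mul1r => /ltW.
have Vv : V <= v.
  rewrite -(ler_pM2r x0) [leRHS]mulrC; apply: le_trans xv; apply: le_trans (ltW Wx).
  by rewrite ler_wpM2r ?le_max ?lexx// ltW.
have uN0 : u != 0 by rewrite gt_eqF.
have -> : x * v = (x / u) * (u * v) by rewrite mulrA divfK.
apply: (@le_trans _ _ ((W * (x / u)) `^ q * M (u * v))).
  apply: IH; first by rewrite divr_gt0.
  - by rewrite ler_pdivrMr// mul1r.
  - by rewrite mulrA divfK.
  - by rewrite ltr_pdivlMr// -exprSr.
have -> : W * x = (W * (x / u)) * u by rewrite -mulrA divfK.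
have wx0 : 0 <= W * (x / u) by rewrite mulr_ge0 ?divr_ge0 // ltW.
rewrite [leRHS](_ : _ = (W * (x / u)) `^ q * (u `^ q * M v)).
  by rewrite ler_wpM2l ?powR_ge0// Hn.
by rewrite powRM ?(ltW u0)// -mulrA.
Qed.

(** An exponent [q = p_M + e] costs a factor [u^e]. As [v] may depend on [u], so may [e], and the
    loss can be fixed at 1/2 for all [u]. *)
Lemma Mv_ge_pow u V : delta2_infty M -> 0 <= u <= 1 ->
  exists2 v, V <= v /\ 1 <= v & 2^-1 * u `^ fine (pM M) <= Mv M v u.
Proof.
move=> HD /andP[u0 u1]; set p := fine (pM M).
have pE : pM M = p%:E.
  by rewrite fineK// ge0_fin_numE ?pM_lty// (le_trans _ pM_ge1)// lee_fin.
have p1 : 1 <= p by rewrite -lee_fin -pE pM_ge1.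
pose v1 := Num.max V 1.
have hv1 : V <= v1 /\ 1 <= v1 by rewrite !le_max !lexx orbT.
have v10 : 0 <= v1 by exact: le_trans hv1.2.
have [->|uN0] := eqVneq u 0.
  by exists v1 => //; rewrite powR0 ?mulr0 ?Mv_ge0// gt_eqF// (lt_le_trans _ p1).
have [->|uN1] := eqVneq u 1.
  exists v1 => //; rewrite powR1 /Mv mul1r divff ?gt_eqF ?orlicz_gt0 ?hv1.2//.
  by lra.
have up : 0 < u by rewrite lt0r uN0.
have ult : u < 1 by rewrite lt_neqAle uN1.
(* The solution of [u^e = 1/2], positive because [0 < u < 1]; hence the separate treatment of the
   endpoints. *)
pose e := ln 2 / - ln u.
have lnu : ln u < 0 by rewrite ln_lt0// up.
have e0 : 0 < e by rewrite divr_gt0 ?oppr_gt0// ln_gt0// ltr1n.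
have [|||v hv Hv] := @index_gt u (p + e) V.
- by rewrite up.
- by rewrite (le_trans p1)// lerDl ltW.
- by rewrite pE lte_fin ltrDl.
exists v => //; rewrite /Mv ler_pdivlMr ?orlicz_gt0 ?hv.2//; apply/ltW.
apply: le_lt_trans Hv; rewrite powRD ?uN0 ?implybT//.
suff -> : u `^ e = 2^-1 by rewrite (mulrC 2^-1).
rewrite /powR (negbTE uN0) /e invrN mulrN mulNr divfK ?lt_eqF//.
by rewrite expRN lnK// posrE.
Qed.

Lemma lp_norm_le (a : nat -> R) (l : R) : delta2_infty M -> 0 < l -> beta_ball a l ->
  (lp_norm (fine (pM M)) a <= (2 * l)%:E)%E.
Proof.
move=> HD l0 H; set p := fine (pM M).
have p1 : 1 <= p.
  rewrite -lee_fin fineK ?pM_ge1// ge0_fin_numE ?pM_lty//.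
  by rewrite (le_trans _ pM_ge1)// lee_fin.
have p0 : 0 < p by exact: lt_le_trans p1.
have al0 i : 0 <= `|a i| / l by rewrite divr_ge0// ltW.
have al1 k : `|a k| / l <= 1.
  have [b bB _] := calB_ge (fun=> 0).
  have b0 i : 0 <= b i by rewrite (le_trans ler01)// (calB_ge1).
  apply: (Mv_le1_inv (calB_ge1 k bB)) => //.
  have := H b bB k.+1; rewrite big_ord_recr/=; apply: le_trans.
  by rewrite lerDr sumr_ge0// => i _; rewrite Mv_ge0.
(* A reference member: choosing each [b k] above [w k] keeps [b] in [calB], whatever [v] the index
   provides. *)
have [w wB _] := calB_ge (fun=> 0).
have /choice[b bP] k : exists v, (w k <= v /\ 1 <= v) /\
    2^-1 * (`|a k| / l) `^ p <= Mv M v (`|a k| / l).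
  have := @Mv_ge_pow (`|a k| / l) (w k) HD; rewrite al0 al1 => /(_ isT)[v ? ?].
  by exists v.
have bB : calB M b.
  apply: (calB_of_le (q := fun k => (M (w k))^-1)) => [k|k|]; first by case: (bP k) => -[].
    have [[wb b1] _] := bP k; have w1 := calB_ge1 k wB.
    rewrite lef_pV2 ?posrE ?orlicz_gt0//.
    by rewrite orlicz_le// (le_trans _ w1).
  by have /calBP[] := wB.
have S n : \sum_(i < n) `|a i| `^ p <= (2 * l) `^ p.
  apply: (@le_trans _ _ (2 * l `^ p)); last first.
    rewrite powRM ?(ltW l0)// ler_wpM2r ?powR_ge0//.
    by rewrite -[leLHS]powRr1// ler_powR// ler1n.
  rewrite mulrC -ler_pdivrMl ?powR_gt0// mulr_sumr.
  have := H b bB n.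
  rewrite -(ler_pM2l (x := 2))// mulr1; apply: le_trans; rewrite mulr_sumr.
  apply: ler_sum => i _; have [_] := bP i.
  rewrite powRM ?invr_ge0 ?(ltW l0)// -(powR_inv1 (ltW l0)) -powRrM mulN1r powRN.
  by lra.
rewrite /lp_norm -/p.
have -> : (2 * l)%:E = poweR ((2 * l) `^ p)%:E p^-1.
  by rewrite poweR_EFin -powRrM divff ?gt_eqF// powRr1// mulr_ge0// ltW.
have S0 k : 0 <= `|a k| `^ p by exact: powR_ge0.
have pV : 0 <= p^-1 by rewrite invr_ge0 ltW.
apply: (@gt0_ler_poweR R p^-1 pV _ ((2 * l) `^ p)%:E).
- by rewrite in_itv/= leey nneseries_ge0.
- by rewrite in_itv/= leey lee_fin powR_ge0.
- exact: (nneseries_leP _ S0).2.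
Qed.

(* [s k] is the supremum of [M_v(|a_k| / l)] over [v >= w k]. *)
Lemma beta_ball_envelope a l w : 0 < l -> beta_ball a l -> calB M w ->
  exists2 s : nat -> R, forall k, 0 <= s k /\
      forall v, w k <= v -> Mv M v (`|a k| / l) <= s k &
    forall n, \sum_(i < n) s i <= 2.
Proof.
move=> l0 H wB; have w1 k := calB_ge1 k wB; have w0 k := le_trans ler01 (w1 k).
have al0 k : 0 <= `|a k| / l by rewrite divr_ge0// ltW.
pose E k := [set Mv M v (`|a k| / l) | v in [set v | w k <= v]].
(* Raising the single term [w k] to [v] stays in [calB], so one coordinate of the ball inequality
   bounds the supremum. *)
have E_le1 k v : w k <= v -> Mv M v (`|a k| / l) <= 1.
  move=> wv; pose b j := if j == k then v else w j.
  have b_ge j : w j <= b j by rewrite /b; case: eqP => [->|].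
  have bB : calB M b.
    apply: (calB_of_le (q := fun k => (M (w k))^-1)) => [j|j|].
    - exact: le_trans (b_ge j).
    - rewrite lef_pV2 ?posrE ?orlicz_gt0//; first exact: orlicz_le.
      exact: le_trans (b_ge j).
    - by have /calBP[] := wB.
  have := H b bB k.+1; rewrite big_ord_recr/= {2}/b eqxx; apply: le_trans.
  by rewrite lerDr sumr_ge0// => i _; rewrite Mv_ge0// (le_trans _ (b_ge i)).
have supE k : has_sup (E k).
  split; first by exists (Mv M (w k) (`|a k| / l)), (w k) => /=.
  by exists 1 => _ [v wv <-]; exact: E_le1.
have E_ub k v : w k <= v -> Mv M v (`|a k| / l) <= sup (E k).
  by move=> wv; apply: ub_le_sup; [exact: (supE k).2|exists v].
have s0 k : 0 <= sup (E k) by apply: le_trans (E_ub k (w k) (lexx _)); rewrite Mv_ge0.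
exists (fun k => sup (E k)) => [k|n]; first by split=> // v; exact: E_ub.
(* Half of each supremum is reached by some [b k >= w k], and this [b] is in [calB]; hence the total
   2. If the supremum is 0, [w k] itself serves. *)
have /choice[b bP] k : exists v, w k <= v /\ 2^-1 * sup (E k) <= Mv M v (`|a k| / l).
  have [sk|sk] := leP (sup (E k)) 0.
    exists (w k); split=> //; apply: (@le_trans _ _ 0); last by rewrite Mv_ge0.
    by rewrite mulr_ge0_le0.
  have h : 0 < 2^-1 * sup (E k) by rewrite mulr_gt0.
  have [_ [v wv <-] Hv] := sup_adherent h (supE k).
  by exists v; split=> //; apply: ltW; apply: le_lt_trans Hv; lra.
have bB : calB M b.
  apply: (calB_of_le (q := fun k => (M (w k))^-1)) => [j|j|].
  - exact: le_trans (bP j).1.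
  - rewrite lef_pV2 ?posrE ?orlicz_gt0//; first by apply: orlicz_le => //; exact: (bP j).1.
    exact: le_trans (bP j).1.
  - by have /calBP[] := wB.
rewrite -(ler_pM2l (x := 2^-1)) ?invr_gt0// mulVf// mulr_sumr.
by apply: le_trans (H b bB n); apply: ler_sum => i _; exact: (bP i).2.
Qed.

(** * Modulars of disjoint sums *)

Local Notation mu := (@lebesgue_measure R).
Local Notation D := (`[0%R, 1%R]%classic : set R).

Lemma lebesgue_unit_itv : mu D = 1%E.
Proof. by rewrite lebesgue_measure_itv/= lte_fin ltr01 oppr0 adde0. Qed.

Lemma measurable_modular (f : R -> R) (l : R) : 0 < l -> measurable_fun D f ->
  measurable_fun D (fun x => (M (`|f x| / l))%:E).
Proof.
move=> l0 mf; apply/measurable_EFinP.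
(* [M] is monotone only on the half-line; truncating at 0 makes it monotone, hence measurable, on
   all of [R]. *)
pose N y := M (Num.max y 0).
rewrite (_ : (fun x => _) = N \o (fun x => `|f x| / l)); last first.
  by apply/funext => x /=; rewrite /N max_l// divr_ge0// ltW.
apply: measurableT_comp.
  apply: nondecreasing_measurable => // x y xy.
  apply: orlicz_le; first by rewrite le_max lexx orbT.
  by rewrite ge_max !le_max xy lexx !orbT.
by apply: measurable_funM => //; apply: measurableT_comp.
Qed.

Lemma lux_norm_lt (f : R -> R) (l : R) : 0 < l -> measurable_fun D f ->
  (lux_norm M f < l%:E)%E -> (\int[mu]_(x in D) (M (`|f x| / l))%:E <= 1)%E.
Proof.
move=> l0 mf; apply: inf_norm_lt => s t s0 st; apply: le_trans.
have t0 : 0 < t by exact: lt_le_trans st.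
have MN r x : 0 < r -> (0 <= (M (`|f x| / r))%:E)%E.
  by move=> r0; rewrite lee_fin orlicz_ge0// divr_ge0// ltW.
apply: ge0_le_integral => //; try exact: measurable_modular.
- by move=> x _; exact: MN.
- move=> x _; rewrite lee_fin orlicz_le ?divr_ge0 ?(ltW t0)// ler_wpM2l//.
  by rewrite lef_pV2.
Qed.

(** At most one [F i] is nonzero, so both sides reduce to a single term. *)
Lemma disjoint_sum_map (G : R -> R) n (F : nat -> R) : G 0 = 0 ->
  (forall i j, i != j -> F i = 0 \/ F j = 0) ->
  G (\sum_(i < n) F i) = \sum_(i < n) G (F i).
Proof.
move=> G0 Fd; have [/existsP[i0 Fi0]|/existsPn F0] := boolP [exists i : 'I_n, F i != 0].
  have F0 i : i != i0 -> F i = 0.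
    move=> ii0; have [//|Fi0'] := Fd i i0 ii0.
    by rewrite Fi0' eqxx in Fi0.
  rewrite (bigD1 i0)//= big1 ?addr0; last by move=> i /F0.
  by rewrite (bigD1 i0)//= big1 ?addr0// => i /F0 ->.
rewrite !big1 ?G0// => i _; first by have := F0 i; rewrite negbK => /eqP ->.
by have := F0 i; rewrite negbK => /eqP.
Qed.

(** One null set serves all pairs; finite tuples are padded with zero functions. *)
Definition ae_disjoint (X : nat -> R -> R) :=
  \forall t \ae mu, D t -> forall i j, i != j -> X i t = 0 \/ X j t = 0.

Lemma measurable_support (X : R -> R) : measurable_fun D X ->
  measurable (D `&` [set t | X t != 0]).
Proof.
move=> mX; rewrite (_ : [set t | X t != 0] = X @^-1` (~` [set 0])).
  by apply: mX => //; apply: measurableC; exact: measurable_set1.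
by apply/seteqP; split=> t /= /eqP.
Qed.

Lemma measure_support (X : nat -> R -> R) : (forall i, measurable_fun D (X i)) ->
  ae_disjoint X ->
  exists2 p : nat -> R, (forall i, 0 <= p i /\ mu (D `&` [set t | X i t != 0]) = (p i)%:E) &
    forall n, \sum_(i < n) p i <= 1.
Proof.
move=> mX dX; pose S i := D `&` [set t | X i t != 0].
have mS i : measurable (S i) by exact: measurable_support.
have muS i : (mu (S i) <= 1)%E.
  by rewrite -lebesgue_unit_itv; apply: le_measure; [apply: mem_set; exact: mS|apply: mem_set; exact: measurable_itv|exact: subIsetl].
have pE i : mu (S i) = (fine (mu (S i)))%:E.
  by rewrite fineK// ge0_fin_numE// (le_lt_trans (muS i))// ltry.
exists (fun i => fine (mu (S i))) => [i|n]; first by split; [exact: fine_ge0|exact: pE].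
rewrite -lee_fin -sumEFin.
under eq_bigr do rewrite -pE.
have -> : \sum_(i < n) mu (S i) = (\int[mu]_(x in D) \sum_(i < n) (\1_(S i) x)%:E)%E.
  rewrite ge0_integral_sum//; last first.
    by move=> i; apply/measurable_EFinP; apply: measurable_indic; exact: mS.
  apply: eq_bigr => i _; rewrite integral_indic//; last exact: mS.
  by congr (mu _); rewrite setIC setIA setIid.
rewrite -lebesgue_unit_itv -[leRHS]mul1e -integral_cst//.
apply: ae_ge0_le_integral => //.
- by move=> t _; apply: sume_ge0 => i _; rewrite lee_fin.
- by apply: emeasurable_sum => i; apply/measurable_EFinP; apply: measurable_indic; exact: mS.
- apply: (@filterS _ _ (ae_filter_ringOfSetsType mu) _ _ _ dX) => t {}dX Dt.
  rewrite sumEFin lee_fin.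
  (* This choice of [G] counts the supports containing [t]: the count is 0 or 1. *)
  have := @disjoint_sum_map (fun y => (y != 0)%:R) n (X ^~ t) _ (dX Dt).
  rewrite eqxx => /(_ erefl) h.
  rewrite (eq_bigr (fun i : 'I_n => (X i t != 0)%:R)) -?h ?lern1 ?leq_b1// => i _.
  rewrite indicE /S; congr ((nat_of_bool _)%:R); apply/idP/idP; rewrite inE /=.
    by case.
  by split.
Qed.

(** The 12 is [2 * 3 * 2]: the level 2 of the modulars of [X i], the bound 3 on the integral of
    [g i], and the bound 2 on the sum of the [s i]. *)
Lemma modular_disjoint_sum_le a l (X : nat -> R -> R) n : 0 < l -> beta_ball a l ->
  (forall i, measurable_fun D (X i)) -> ae_disjoint X ->
  (forall i, (\int[mu]_(x in D) (M (`|X i x| / 2))%:E <= 1)%E) ->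
  (\int[mu]_(x in D) (M (`|\sum_(i < n) a i * X i x| / (12 * l)))%:E <= 1)%E.
Proof.
move=> l0 H mX dX X1; have [p pP pS] := measure_support mX dX.
have l12 : 0 < 12 * l by rewrite mulr_gt0.
have p1 k : p k <= 1.
  have := pS k.+1; rewrite big_ord_recr/=; apply: le_trans; rewrite lerDr.
  by apply: sumr_ge0 => i _; exact: (pP i).1.
have h0 k : 0 < (2^-1 : R) ^+ k.+1 by rewrite exprn_gt0// invr_gt0.
have h1 k : (2^-1 : R) ^+ k.+1 <= 1 by rewrite exprn_ile1// invf_le1 ?ler1n.
(* The geometric term keeps [q k] positive where [X k] vanishes. *)
pose q k := (p k + 2^-1 ^+ k.+1) / 2.
have q0 k : 0 < q k by have := h0 k; have [] := pP k; rewrite /q; lra.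
have /choice[w wP] k : exists v, 1 <= v /\ M v = (q k)^-1.
  have [|v v1 Mv] := @orlicz_surj (q k)^-1; last by exists v.
  by rewrite invf_ge1//; have := h1 k; have := p1 k; rewrite /q; lra.
have wB : calB M w.
  apply: (calB_of_le (q := q)) => [k|k|m]; first exact: (wP k).1.
    by rewrite (wP k).2 invrK.
  rewrite -mulr_suml big_split/=; have := pS m; have := @sum_half_le1 R m; lra.
have [s sP s2] := beta_ball_envelope l0 H wB.
have Mw0 k : 0 <= M (w k) by rewrite (wP k).2 invr_ge0 ltW.
have Mwp k : M (w k) * p k <= 2.
  by rewrite (wP k).2 ler_pdivrMl//; have := h0 k; rewrite /q; lra.
pose S i := D `&` [set t | X i t != 0].
have mS i : measurable (S i) by exact: measurable_support.
pose g i t := M (w i) * \1_(S i) t + M (`|X i t| / 2).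
have g0 i t : 0 <= g i t by rewrite addr_ge0 ?mulr_ge0// orlicz_ge0// divr_ge0.
(* Below the level [w i] the value [`|X i t| / 2] is replaced by [w i]; this is
   paid for by the term of [g] supported on [S i]. *)
have pt i t : D t -> M (`|a i * X i t| / (12 * l)) <= s i / 6 * g i t.
  move=> Dt; pose u := `|a i| / l; pose Y := `|X i t| / 2.
  have u0 : 0 <= u by rewrite divr_ge0// ltW.
  have Y0 : 0 <= Y by rewrite divr_ge0.
  have [si0 si] := sP i.
  have -> : `|a i * X i t| / (12 * l) = 6^-1 * (u * Y).
    by rewrite normrM /u /Y; field; rewrite gt_eqF.
  have uY0 : 0 <= u * Y by rewrite mulr_ge0.
  apply: (@le_trans _ _ (6^-1 * M (u * Y))); first by apply: orlicz_scale => //; lra.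
  rewrite (mulrC (s i)) -[leRHS]mulrA ler_wpM2l//.
  have Mb v : w i <= v -> M (u * v) <= s i * M v.
    by move=> wv; have := si v wv; rewrite ler_pdivrMr// orlicz_gt0// (le_trans (wP i).1).
  have [Yw|/ltW Yw] := leP Y (w i); last first.
    apply: le_trans (Mb _ Yw) _; rewrite ler_wpM2l// /g lerDr.
    by rewrite mulr_ge0.
  have [X0|X0] := eqVneq (X i t) 0.
    by rewrite /Y X0 normr0 mul0r mulr0 orlicz0 mulr_ge0.
  apply: le_trans (_ : M (u * w i) <= _); first by rewrite orlicz_le// ler_wpM2l.
  apply: le_trans (Mb _ (lexx _)) _; rewrite ler_wpM2l// /g indicE mem_set ?mulr1 ?lerDl//.
  by rewrite orlicz_ge0.
have mg i : measurable_fun D (fun t => (g i t)%:E).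
  apply/measurable_EFinP; apply: measurable_funD.
    by apply: measurable_funM => //; apply: measurable_indic; exact: mS.
  by apply/measurable_EFinP; exact: measurable_modular.
have mh i : measurable_fun D (fun t => (s i / 6)%:E * (g i t)%:E)%E.
  by apply: emeasurable_funM.
have s60 i : 0 <= s i / 6 by have [] := sP i; lra.
have intg i : (\int[mu]_(x in D) ((s i / 6)%:E * (g i x)%:E) <= (s i / 2)%:E)%E.
  rewrite ge0_integralZl_EFin//; last 2 first.
  - by move=> t _; rewrite lee_fin.
  - exact: mg.
  have -> : ((s i / 2)%:E = (s i / 6)%:E * (2 + 1)%:E)%E.
    by rewrite -EFinM; congr EFin; lra.
  rewrite lee_wpmul2l ?lee_fin//.
  rewrite /g; under eq_integral do rewrite EFinD EFinM.
  rewrite ge0_integralD//; first last.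
  - exact: measurable_modular.
  - by move=> t _; rewrite lee_fin orlicz_ge0// divr_ge0.
  - by apply/measurable_EFinP; apply: measurable_funM => //; apply: measurable_indic; exact: mS.
  - by move=> t _; rewrite -EFinM lee_fin mulr_ge0.
  rewrite EFinD leeD//.
  rewrite ge0_integralZl_EFin//; first last.
  - by apply/measurable_EFinP; apply: measurable_indic; exact: mS.
  rewrite integral_indic//; last exact: mS.
  rewrite (_ : S i `&` D = S i); last by rewrite setIC setIA setIid.
  by rewrite [X in (_ * X)%E](pP i).2 -EFinM lee_fin.
apply: (@le_trans _ _ (\int[mu]_(x in D) \sum_(i < n) ((s i / 6)%:E * (g i x)%:E))%E).
  apply: ae_ge0_le_integral => //.
  - by move=> t _; rewrite lee_fin orlicz_ge0// divr_ge0// ltW.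
  - apply: measurable_modular => //; apply: measurable_sum => i.
    exact: measurable_funM.
  - by move=> t _; apply: sume_ge0 => i _; rewrite -EFinM lee_fin mulr_ge0.
  - by apply: emeasurable_sum => i; exact: mh.
  - apply: (@filterS _ _ (ae_filter_ringOfSetsType mu) _ _ _ dX) => t {}dX Dt.
    under [leRHS]eq_bigr do rewrite -EFinM.
    rewrite sumEFin lee_fin.
    rewrite (@disjoint_sum_map (fun y => M (`|y| / (12 * l))) n (fun i => a i * X i t)).
    + by apply: ler_sum => i _; exact: pt.
    + by rewrite normr0 mul0r orlicz0.
    + by move=> i j /(dX Dt)[->|->]; rewrite mulr0; [left|right].
rewrite ge0_integral_sum//; last 2 first.
- by move=> i; exact: mh.
- by move=> i t _; rewrite -EFinM lee_fin mulr_ge0.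
apply: (@le_trans _ _ (\sum_(i < n) (s i / 2)%:E)%E); first by apply: lee_sum => i _; exact: intg.
rewrite sumEFin -[leRHS]/(1%:E) lee_fin -mulr_suml; have := s2 n; lra.
Qed.

(** Only finitely many pairs occur, so their exceptional null sets can be merged. *)
Lemma frakB_ae_disjoint n (x : 'I_n -> R -> R) : frakB M x ->
  ae_disjoint (fun k => if insub k is Some i then x i else cst 0).
Proof.
move=> [_ dx].
have FF := ae_filter_ringOfSetsType mu.
have : \forall t \ae mu, forall i j : 'I_n, i != j -> D t -> x i t = 0 \/ x j t = 0.
  apply: (@filter_forall _ _ _ _ FF) => i; apply: (@filter_forall _ _ _ _ FF) => j.
  have [->|ij] := eqVneq i j; first by apply: (@aeW _ _ _ mu).
  apply: negligibleS (dx i j ij) => t /= H; apply: contrapT => H2; apply: H => _ Dt.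
  have [xi|xi] := eqVneq (x i t) 0; first by left.
  have [xj|xj] := eqVneq (x j t) 0; first by right.
  exfalso; apply: H2; split=> //; rewrite gt_eqF// lt_min !normr_gt0 xi.
  exact: xj.
apply: (@filterS _ _ FF) => t H Dt i j ij.
case: insubP => [i' _ ii'|_]; last by left.
case: insubP => [j' _ jj'|_]; last by right.
by apply: H => //; apply: contraNneq ij => ij; rewrite -ii' -jj' ij.
Qed.

(** * Comparison of [(L_M)_U] with [Delta] *)

Lemma XU_norm_le (a : nat -> R) (l : R) : 0 < l -> beta_ball a l -> (XU_norm M a <= (12 * l)%:E)%E.
Proof.
move=> l0 H; apply: ge_ereal_sup => _ [n _ <-].
apply: ge_ereal_sup => _ [x xB <-].
pose X k : R -> R := if insub k is Some i then x i else cst 0.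
have -> : (fun t => \sum_(i < n) a i * x i t) = fun t => \sum_(i < n) a i * X i t.
  by apply/funext => t; apply: eq_bigr => i _; rewrite /X valK.
have mX k : measurable_fun D (X k).
  by rewrite /X; case: insubP => [i _ _|_]; [exact: (xB.1 i).1|exact: measurable_cst].
apply: inf_norm_le; first by rewrite mulr_gt0.
apply: modular_disjoint_sum_le => //; first exact: frakB_ae_disjoint.
(* Norm one lies strictly below 2, so the modular at level 2 is at most 1 without attaining the
   infimum. *)
move=> k; apply: lux_norm_lt => //; rewrite /X; case: insubP => [i _ _|_].
  by rewrite (xB.1 i).2 lte_fin ltr1n.
apply: (@le_lt_trans _ _ 1%:E); last by rewrite lte_fin ltr1n.
apply: inf_norm_le => //.
rewrite integral0_eq// => t _; by rewrite /= normr0 mul0r orlicz0.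
Qed.

Lemma modular_step_sum (A : nat -> set R) (d : nat -> R) n (l : R) : 0 < l ->
  (forall i, measurable (A i) /\ A i `<=` D) ->
  (forall i j, i != j -> A i `&` A j = set0) ->
  (\int[mu]_(x in D) (M (`|\sum_(i < n) d i * \1_(A i) x| / l))%:E =
   \sum_(i < n) (M (`|d i| / l))%:E * mu (A i))%E.
Proof.
move=> l0 AP dA; have Ml0 y : 0 <= M (`|y| / l) by rewrite orlicz_ge0// divr_ge0// ltW.
have mA i : measurable_fun D (fun x => (\1_(A i) x)%:E : \bar R).
  by apply/measurable_EFinP; apply: measurable_indic; exact: (AP i).1.
transitivity (\int[mu]_(x in D) \sum_(i < n) ((M (`|d i| / l))%:E * (\1_(A i) x)%:E))%E.
  apply: eq_integral => t _; under [RHS]eq_bigr do rewrite -EFinM.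
  rewrite sumEFin; congr EFin.
  rewrite (@disjoint_sum_map (fun y => M (`|y| / l)) n (fun i => d i * \1_(A i) t)).
  - apply: eq_bigr => i _; rewrite indicE; case: (t \in A i).
      by rewrite !mulr1.
    by rewrite !mulr0 normr0 mul0r orlicz0.
  - by rewrite normr0 mul0r orlicz0.
  - move=> i j ij; rewrite /= !indicE.
    case: (boolP (t \in A i)) => ti; last by left; rewrite mulr0.
    case: (boolP (t \in A j)) => tj; last by right; rewrite mulr0.
    by move: ti tj; rewrite !inE => ti tj; have : (A i `&` A j) t by []; rewrite dA.
rewrite ge0_integral_sum//; last 2 first.
- by move=> i; apply: emeasurable_funM => //; exact: mA.
- by move=> i t _; rewrite -EFinM lee_fin mulr_ge0.
apply: eq_bigr => i _; rewrite ge0_integralZl_EFin//; last exact: mA.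
rewrite integral_indic//; last exact: (AP i).1.
by rewrite (setIidl (AP i).2).
Qed.

Lemma XU_norm_lt (a : nat -> R) (l : R) : 0 < l -> (XU_norm M a < l%:E)%E -> beta_ball a l.
Proof.
move=> l0 H b bB n; have b1 k := calB_ge1 k bB; have b0 k := le_trans ler01 (b1 k).
have Mb0 k := orlicz_gt0 (b1 k).
have /calBP[_ bS] := bB.
(* Partial sums are the endpoints of consecutive half-open intervals; they stay in [[0, 1]] since
   [b] is in [calB]. *)
pose c k := \sum_(i < k) (M (b i))^-1.
have cS k : c k.+1 = c k + (M (b k))^-1 by rewrite /c big_ord_recr.
have c_le i j : (i <= j)%N -> c i <= c j.
  move=> /subnK <-; elim: (j - i)%N => // k IH.
  by rewrite addSn cS (le_trans IH)// lerDl invr_ge0 ltW.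
have c0 k : 0 <= c k by apply: le_trans (c_le 0%N k _) => //; rewrite /c big_ord0.
pose A k : set R := `[c k, c k.+1[%classic.
have AP k : measurable (A k) /\ A k `<=` D.
  split; first exact: measurable_itv.
  move=> t; rewrite /A /= !in_itv/= => /andP[ct tc].
  by rewrite (le_trans (c0 k) ct) (le_trans (ltW tc) (bS k.+1)).
have dA i j : i != j -> A i `&` A j = set0.
  suff W i' j' : (i' < j')%N -> A i' `&` A j' = set0.
    by rewrite neq_ltn => /orP[/W//|/W]; rewrite setIC.
  move=> ij; rewrite -subset0 => t []; rewrite /A /= !in_itv/= => /andP[_ ti] /andP[tj _].
  by have := lt_le_trans ti (le_trans (c_le _ _ ij) tj); rewrite ltxx.
have muA k : mu (A k) = ((M (b k))^-1)%:E.
  rewrite /A lebesgue_measure_itv/= lte_fin cS ltrDl invr_gt0 Mb0 -EFinB.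
  by rewrite addrAC subrr add0r.
pose x (i : 'I_n) : R -> R := fun t => b i * \1_(A i) t.
have mx i : measurable_fun D (x i).
  by apply: measurable_funM => //; apply: measurable_indic; exact: (AP i).1.
have xB : frakB M x.
  split=> [i|i j ij]; last first.
    rewrite [X in _.-negligible X](_ : _ = set0); first exact: (negligible_set0 mu).
    rewrite -subset0 => t [_]; rewrite /x !indicE; apply/negP; rewrite negbK.
    case: (boolP (t \in A i)) => ti; last by rewrite mulr0 normr0 min_l.
    case: (boolP (t \in A j)) => tj; last by rewrite mulr0 normr0 min_r.
    by move: ti tj; rewrite !inE => ti tj; have : (A i `&` A j) t by []; rewrite dA.
  split=> //.
  (* Since [A i] has measure [1 / M(b i)], this modular is at most 1 exactly when [r >= 1], so [x i]
     has norm one. *)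
  have mod_x r : 0 < r ->
      (\int[mu]_(t in D) (M (`|x i t| / r))%:E = (Mv M (b i) r^-1)%:E)%E.
    move=> r0; pose A0 k := if k == 0%N then A i else set0.
    have := @modular_step_sum A0 (fun=> b i) 1 r r0.
    under eq_integral do rewrite big_ord1.
    rewrite big_ord1 /A0/= muA -EFinM /Mv (ger0_norm (b0 i)) (mulrC r^-1); apply.
      by case=> [|k]; [exact: AP|split; [exact: measurable0|exact: sub0set]].
    by case=> [|k] [|k']//= _; rewrite ?setI0 ?set0I.
  apply/eqP; rewrite eq_le; apply/andP; split.
    apply: inf_norm_le => //; rewrite mod_x// /Mv invr1 mul1r divff ?gt_eqF//.
  apply: le_ereal_inf_tmp => _ [r [r0 +] <-]; rewrite mod_x// lee_fin => /Mv_le1_inv.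
  by rewrite invr_ge0 (ltW r0) invf_le1// lee_fin; apply.
have xl : (lux_norm M (fun t : R => \sum_(i < n) a i * x i t)%R < l%:E)%E.
  apply: le_lt_trans H; apply: le_ereal_sup_tmp; exists (XUn_norm M n a); first by exists n.
  by apply: ereal_sup_ubound; exists x.
pose d i := a i * b i.
have fE : (fun t : R => \sum_(i < n) a i * x i t) = fun t : R => \sum_(i < n) d i * \1_(A i) t.
  by apply/funext => t; apply: eq_bigr => i _; rewrite mulrA.
rewrite fE in xl.
have mf : measurable_fun D (fun t : R => \sum_(i < n) d i * \1_(A i) t).
  by apply: measurable_sum => i; apply: measurable_funM => //; apply: measurable_indic; exact: (AP i).1.
have : (\sum_(i < n) (M (`|d i| / l))%:E * mu (A i) <= 1)%E.
  by rewrite -(modular_step_sum d n l0 AP dA); exact: (lux_norm_lt l0 mf xl).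
under eq_bigr do rewrite muA -EFinM.
rewrite sumEFin -[X in (_ <= X)%E]/(1%:E) lee_fin; apply: le_trans.
(* The modular of the step function at level [l] is the Musielak-Orlicz sum term by term. *)
by apply: ler_sum => i _; rewrite /Mv /d normrM (ger0_norm (b0 i)) mulrAC.
Qed.

(** The empty tuple already competes in the supremum, so no norm-one function has to be produced. *)
Lemma XU_norm_ge0 (a : nat -> R) : (0 <= XU_norm M a)%E.
Proof.
apply: le_ereal_sup_tmp; exists (XUn_norm M 0 a); first by exists 0%N.
apply: le_ereal_sup_tmp; exists (lux_norm M (fun t => \sum_(i < 0) a i * 0)); last exact: inf_norm_ge0.
by exists (fun _ _ => 0) => //; split; case.
Qed.

End OrliczFunctions.

Theorem mainTheorem18 (R : realType) (M : R -> R) :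
  orlicz_function M -> delta2_infty M ->
  [/\ (* (L_M)_U = Delta(l_{M_beta}) as sets ... *)
      (forall a, in_XU M a <-> in_Delta M a),
      (* ... with equivalent norms *)
      (exists c C : R, 0 < c /\ 0 < C /\ forall a : nat -> R,
         (c%:E * Delta_norm M a <= XU_norm M a)%E /\
         (XU_norm M a <= C%:E * Delta_norm M a)%E),
      (* l_{Phi_M} embeds continuously in (L_M)_U *)
      (exists C : R, 0 < C /\ forall a : nat -> R,
         (XU_norm M a <= C%:E * lPhi_norm M a)%E),
      (* p_M is finite *)
      (pM M < +oo)%E &
      (* (L_M)_U embeds continuously in l_{p_M} *)
      (exists C : R, 0 < C /\ forall a : nat -> R,
         (lp_norm (fine (pM M)) a <= C%:E * XU_norm M a)%E)].
Proof.
move=> HM HD.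
have Delta_le_XU a : (Delta_norm M a <= XU_norm M a)%E.
  rewrite -[leRHS]mul1e; apply: lee_of_gt => // [|l l0 al]; first exact: XU_norm_ge0.
  by rewrite mul1r; apply: Delta_le => //; exact: XU_norm_lt.
have XU_le_Delta a : (XU_norm M a <= 12%:E * Delta_norm M a)%E.
  apply: lee_of_gt => // [|l l0 al]; first exact: Delta_ge0.
  by apply: XU_norm_le => //; exact: Delta_lt.
split.
- move=> a; split=> [aU|[_ aD]].
    have aD : (Delta_norm M a < +oo)%E by exact: le_lt_trans aU.
    split=> // b bB; apply: le_lt_trans aD.
    by apply: ereal_sup_ubound; exists b.
  apply: le_lt_trans (XU_le_Delta a) _; apply: lte_mul_pinfty => //.
- by exists 1, 12; split=> //; split=> // a; rewrite mul1e.
- exists 24; split=> // a; apply: lee_of_gt => // [|l l0 al]; first exact: inf_norm_ge0.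
  (* The factor 2 comes from [lPhi_lt], the factor 12 from [XU_norm_le]. *)
  rewrite (_ : 24 * l = 12 * (2 * l)); last by ring.
  apply: XU_norm_le => //; first by rewrite mulr_gt0.
  exact: lPhi_lt.
- exact: pM_lty.
- exists 2; split=> // a; apply: lee_of_gt => // [|l l0 al]; first exact: XU_norm_ge0.
  by apply: lp_norm_le => //; exact: XU_norm_lt.
Qed.
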